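(* $\mathfrak{dd}=\mathrm{non}(\mathcal M)$ and $\mathfrak{dd}^\perp=\mathrm{cov}(\mathcal M)$. A fortiori, $\mathfrak{rr}\le\mathfrak{dd}$ holds.
   Context: $n\in\omega$ is identified with $\{0,\dots,n-1\}$. For $A\subseteq\omega$, $d(A)=\lim_{n\to\infty}|A\cap n|/n$ if the limit exists (asymptotic density); otherwise $A$ does not have asymptotic density. $\mathrm{Sym}(\omega)$ is the set of permutations of $\omega$. $D$ is the collection of infinite-coinfinite subsets of $\omega$ having asymptotic density. $\mathfrak{dd}$ is the smallest cardinality of a family $\Pi\subseteq\mathrm{Sym}(\omega)$ such that for every $A\in D$ there is $\pi\in\Pi$ such that $d(\pi[A])\ne d(A)$, i.e. either $\pi[A]$ does not have asymptotic density or it has asymptotic density distinct from $d(A)$. $\mathfrak{dd}^\perp$ is the least size of a family $D_0\subseteq D$ such that for all $\pi\in\mathrm{Sym}(\omega)$ there is $x\in D_0$ such that $\pi[x]$ has asymptotic density and $d(\pi[x])=d(x)$. $\mathfrak{rr}$ (the rearrangement number) is the smallest cardinality of a family $\Pi\subseteq\mathrm{Sym}(\omega)$ such that for every conditionally convergent real series $\sum_n a_n$ there is $\pi\in\Pi$ such that $\sum_n a_{\pi(n)}\neq\sum_n a_n$ (where $\sum_n a_{\pi(n)}$ is allowed to converge to $\pm\infty$ or diverge by oscillation). $\mathcal M$ is the meager ideal on $2^\omega$, $\mathrm{non}(\mathcal M)$ is the least size of a nonmeager set of reals, and $\mathrm{cov}(\mathcal M)$ is the least size of a family of meager sets covering $2^\omega$.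 *)

(* Defs.v *)
From mathcomp Require Import all_boot all_order all_algebra.
From mathcomp Require Import all_classical all_reals all_analysis.
Import Order.TTheory GRing.Theory Num.Theory.
Import numFieldNormedType.Exports.

Set Implicit Arguments.
Unset Strict Implicit.
Unset Printing Implicit Defensive.

Local Open Scope classical_set_scope.
Local Open Scope ring_scope.
Local Open Scope card_scope.

(* There is no type of cardinals: the smallest cardinality of a member of [P]
   is represented by a chosen member of [P] of that cardinality, and such
   representatives are compared with [#<=] and [#=].  By [least_cardP] the
   default value [set0] is only used when [P] is empty. *)
Definition least_card (T : Type) (P : set (set T)) : set T :=
  xget set0 [set A | P A /\ forall B, P B -> A #<= B].

(* Cardinals are well-founded: a maximal set of choice functions for [P] that
   pairwise differ on every member of [P] projects onto some member of [P],
   and injectively into all of them. *)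
Lemma least_card_ex (T : Type) (P : set (set T)) : P !=set0 ->
  exists A, P A /\ forall B, P B -> A #<= B.
Proof.
move=> [A0 PA0]; have [P0|P0] := pselect (P set0).
  by exists set0; split=> // B _; exact: card_ge0.
have Pn0 A : P A -> exists x, A x.
  by move=> PA; apply/set0P/eqP => A_eq0; apply: P0; rewrite -A_eq0.
pose choiceful (X : set (set T -> T)) := forall f A, X f -> P A -> A (f A).
pose differ (X : set (set T -> T)) :=
  forall f g A, X f -> X g -> P A -> f A = g A -> f = g.
have [F FP Ftot|X [[Xc Xd] Xmax]] :=
    @Zorn_bigcup _ (fun X => choiceful X /\ differ X).
  split=> [f A [Y FY Yf] PA|f g A [Y FY Yf] [Z FZ Zg] PA].
    by have [Yc _] := FP _ FY; exact: (Yc _ _ Yf PA).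
  have [YZ|ZY] := Ftot _ _ FY FZ.
    by have [_ Zd] := FP _ FZ; exact: (Zd _ _ _ (YZ _ Yf) Zg PA).
  by have [_ Yd] := FP _ FY; exact: (Yd _ _ _ Yf (ZY _ Zg) PA).
have [A [PA Aonto]] : exists A, P A /\ forall x, A x -> exists2 f, X f & f A = x.
  apply: contrapT => noA.
  have fresh A : exists x, P A -> A x /\ forall f, X f -> f A <> x.
    have [PA|nPA] := pselect (P A); last by have [x] := Pn0 _ PA0; exists x.
    apply: contrapT => nox; apply: noA; exists A; split=> // x Ax.
    apply: contrapT => nof; apply: nox; exists x => _; split=> // f Xf fAx.
    by apply: nof; exists f.
  have [h hP] := choice fresh.
  have Xh : ~ X h by move=> Xh; exact: ((hP _ PA0).2 _ Xh erefl).
  apply: (Xmax (X `|` [set h])); last split.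
  - by split=> [f Xf|XhX]; [left|apply: Xh; apply: XhX; right].
  - by move=> f B [Xf|->] PB; [exact: (Xc _ _ Xf PB)|exact: (hP _ PB).1].
  - move=> f g B [Xf|->] [Xg|->] PB //; first exact: (Xd _ _ _ Xf Xg PB).
    + by move=> /((hP _ PB).2 f Xf).
    + by move=> /esym/((hP _ PB).2 g Xg).
exists A; split=> // B PB.
have [k kP] : exists k : T -> (set T -> T), forall x, A x -> X (k x) /\ k x A = x.
  have [|k kP] := @choice _ _ (fun x f => A x -> X f /\ f A = x); last by exists k.
  move=> x; have [Ax|nAx] := pselect (A x); last by exists (fun=> x).
  by have [f Xf fA] := Aonto _ Ax; exists f.
suff [f] : $|{injfun A >-> B}| by exact: inj_card_le.
apply/injfunPex; exists (fun x => k x B) => [x Ax|x y /set_mem Ax /set_mem Ay kB].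
  exact: (Xc _ _ (kP _ Ax).1 PB).
rewrite -(kP _ Ax).2 -(kP _ Ay).2.
by rewrite (Xd _ _ _ (kP _ Ax).1 (kP _ Ay).1 PB kB).
Qed.

Lemma least_cardP (T : Type) (P : set (set T)) : P !=set0 ->
  P (least_card P) /\ forall B, P B -> least_card P #<= B.
Proof. by move=> /least_card_ex; exact: xgetPex. Qed.

Definition Sym : set (nat -> nat) := [set p | bijective p].

Section density.
Variable R : realType.

Definition initial_freq (A : set nat) : R^nat :=
  fun n => #|[pred i : 'I_n | (i : nat) \in A]|%:R / n%:R.

Definition has_density (A : set nat) : Prop := cvgn (initial_freq A).

(* Meaningful only when [has_density A]. *)
Definition density (A : set nat) : R := limn (initial_freq A).

Definition D : set (set nat) :=
  [set A | [/\ infinite_set A, infinite_set (~` A) & has_density A]].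

Definition dd : set (nat -> nat) :=
  least_card [set Pi | Pi `<=` Sym /\
    forall A, D A -> exists2 p, Pi p &
      ~ has_density (p @` A) \/ density (p @` A) <> density A].

Definition dd_perp : set (set nat) :=
  least_card [set D0 | D0 `<=` D /\
    forall p, Sym p -> exists2 A, D0 A &
      has_density (p @` A) /\ density (p @` A) = density A].

Definition conditionally_convergent (a : R^nat) : Prop :=
  cvgn (series a) /\ ~ cvgn [normed series a].

Definition rr : set (nat -> nat) :=
  least_card [set Pi | Pi `<=` Sym /\
    forall a, conditionally_convergent a -> exists2 p, Pi p &
      ~ cvgn (series (a \o p)) \/ limn (series (a \o p)) <> limn (series a)].

End density.

Definition nowhere_dense (T : topologicalType) (A : set T) : Prop :=
  interior (closure A) = set0.

Definition meager (T : topologicalType) (A : set T) : Prop :=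
  exists F : (set T)^nat,
    (forall n, nowhere_dense (F n)) /\ A = \bigcup_n F n.

Definition nonM : set cantor_space := least_card [set A | ~ meager A].

Definition covM : set (set cantor_space) :=
  least_card [set F | (forall A, F A -> meager A) /\
    \bigcup_(A in F) A = setT].

(* Main.v *)
Require Import Defs.
From mathcomp Require Import all_boot all_order all_algebra.
From mathcomp Require Import all_classical all_reals all_analysis.
From mathcomp Require Import zify lra.
Import Order.TTheory GRing.Theory Num.Theory.
Import numFieldNormedType.Exports.

Set Implicit Arguments.
Unset Strict Implicit.
Unset Printing Implicit Defensive.

Local Open Scope classical_set_scope.
Local Open Scope card_scope.

(** Why the theorem is true.

    Upper bounds by category (dd <= non(M), rr <= non(M), and dually
    cov(M) <= dd_perp).  A point x of the Cantor space is read as a recipe for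
    enumerating the natural numbers: bit by bit it decides whether the next
    number is listed at once or postponed, and when the postponed numbers are
    listed.  For a generic x the recipe can list, again and again, only
    elements of a prescribed infinite set for as long as desired
    ([generic_enumeration]).  Applied to A and to its complement this makes the
    frequency of A along the enumeration oscillate between 1/3 and 2/3
    ([density_breaking]); applied to the positive terms of a conditionally
    convergent series, whose sum is infinite, it makes the rearranged partial
    sums unbounded ([series_breaking]).  Hence, for each A (resp. each series),
    the x whose permutation does no harm form a meager set, so that every
    nonmeager set of x yields a witness for dd (resp. rr), and the meager sets
    attached to a witness for dd_perp cover the Cantor space.

    Lower bounds (non(M) <= dd, dd_perp <= cov(M)).  Only sets of density zero
    are used.  If v_0, v_1, ... are numbers with v_n >= n^2 and p is a
    permutation that does not send the range of v to a set of density zero,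
    then p(v_n) < n^2 for infinitely many n: the set of the first n^2 values of
    the inverse of p then captures v_n.  Letting v_n code n^2 values of a
    function g at distinct places of an infinite set X, a diagonal argument
    turns p into a function Z p that agrees with g at infinitely many places of
    X ([sparse_prediction]).  A meager set only contains points that, for all
    large n, differ from some pattern Y n somewhere between n and B n
    ([meager_windows]).  A first permutation p predicts the growth of B, hence
    a partition of the natural numbers into windows infinitely many of which
    are long enough to contain such an interval; a second permutation q then
    predicts the patterns on these long windows, and so defines a point outside
    the meager set ([two_step_prediction]).

    A witness Pi of dd thus produces a nonmeager set indexed by Pi x Pi, which
    has the cardinality of Pi because an infinite set is equinumerous with its
    square ([card_square]).  For dd_perp the two steps become a case
    distinction: given a cover of the Cantor space by meager sets, either the first family of sets of density
    zero is already good, or one p that destroys it all can be fixed, and then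
    the second family is good ([density_kept_family_le]). *)

(** * Infinite cardinals: comparability and squares *)

Lemma card_le_funP (T U : Type) (A : set T) (B : set U) (v : U) :
  A #<= B -> exists2 f : T -> U, set_fun A B f & set_inj A f.
Proof. by move=> /card_leP[f]; apply/injfunPex; squash (valLR v f). Qed.

Lemma fun_card_le (T U : Type) (A : set T) (B : set U) (f : T -> U) :
  set_fun A B f -> set_inj A f -> A #<= B.
Proof.
move=> fAB finj; have [g] : $|{injfun A >-> B}| by apply/injfunPex; exists f.
exact: inj_card_le.
Qed.

(** The well-foundedness of cardinals, applied to a family of two sets. *)
Lemma card_le_total (T : Type) (A B : set T) : A #<= B \/ B #<= A.
Proof.
have [|E [[->|->] EP]] := @least_card_ex T [set E | E = A \/ E = B].
- by exists A; left.
- by left; apply: EP; right.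
- by right; apply: EP; left.
Qed.

Section square.
Variables (T : Type) (A : set T).

(** In this section an injection from B x B to B is represented by its graph
    [G], and B is recovered as [field_of G]: graphs, unlike functions, are
    ordered by inclusion, as Zorn's lemma requires. *)
Definition field_of (G : set (T * T * T)) : set T := [set b | exists c, G (b, b, c)].

Definition square_injection (G : set (T * T * T)) : Prop :=
  [/\ forall b b' c, G (b, b', c) ->
        [/\ field_of G b, field_of G b', field_of G c & A b],
      forall b b', field_of G b -> field_of G b' -> exists c, G (b, b', c),
      forall b b' c c', G (b, b', c) -> G (b, b', c') -> c = c' &
      forall b b' d d' c, G (b, b', c) -> G (d, d', c) -> b = d /\ b' = d'].

Lemma field_ofS (G H : set (T * T * T)) : G `<=` H -> field_of G `<=` field_of H.
Proof. by move=> GH b [c /GH]; exists c. Qed.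

Lemma square_injection_bigcup (F : set (set (T * T * T))) :
  total_on F subset -> F `<=` square_injection ->
  square_injection (\bigcup_(G in F) G).
Proof.
move=> Ftot FP; set U := \bigcup_(G in F) G.
have two s t : U s -> U t -> exists2 G, F G & G s /\ G t.
  move=> [G FG Gs] [H FH Ht]; have [GH|HG] := Ftot _ _ FG FH.
    by exists H => //; split=> //; exact: GH.
  by exists G => //; split=> //; exact: HG.
split=> [b b' c [G FG Gb]|b b' [c Ubc] [c' Ubc']|b b' c c' Uc Uc'|b b' d d' c Ub Ud].
- have [+ _ _ _] := FP G FG => /(_ _ _ _ Gb)[b1 b2 b3 b4].
  by split=> //; [move: b1|move: b2|move: b3]; apply: field_ofS => t Gt; exists G.
- have [G FG [Gb Gb']] := two _ _ Ubc Ubc'.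
  have [_ + _ _] := FP G FG => /(_ b b')[||c'' Gc'']; [by exists c|by exists c'|].
  by exists c''; exists G.
- have [G FG [Gb Gb']] := two _ _ Uc Uc'.
  by have [_ _ + _] := FP G FG; apply; [exact: Gb|exact: Gb'].
- have [G FG [Gb Gd]] := two _ _ Ub Ud.
  by have [_ _ _ +] := FP G FG; apply; [exact: Gb|exact: Gd].
Qed.

Lemma square_injection_fun G : square_injection G ->
  exists2 h : T -> T -> T,
    (forall b b', field_of G b -> field_of G b' -> G (b, b', h b b')) &
    (forall b b' d d', field_of G b -> field_of G b' -> field_of G d -> field_of G d' ->
      h b b' = h d d' -> b = d /\ b' = d').
Proof.
move=> [_ Gtot _ Ginj].
have value (q : T * T) :
    exists c, field_of G q.1 -> field_of G q.2 -> G (q.1, q.2, c).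
  have [[fb fb']|nf] := pselect (field_of G q.1 /\ field_of G q.2).
    by have [c] := Gtot _ _ fb fb'; exists c.
  by exists q.1 => fb fb'; exfalso; apply: nf.
have [h hP] := choice value.
exists (fun b b' => h (b, b')) => [b b' fb fb'|b b' d d' fb fb' fd fd' hh].
  exact: (hP (b, b')).
apply: Ginj; first exact: (hP (b, b')).
by rewrite hh; exact: (hP (d, d')).
Qed.

(** B x B contains two disjoint copies B x {b0} and B x {b1} of B, so B absorbs
    any set whose part outside B injects into B. *)
Lemma doubling_injection G (b0 b1 : T) (E : set T) (v : T -> T) :
  square_injection G -> field_of G b0 -> field_of G b1 -> b0 <> b1 ->
  set_fun (E `\` field_of G) (field_of G) v -> set_inj (E `\` field_of G) v ->
  exists2 u : T -> T, set_fun E (field_of G) u & set_inj E u.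
Proof.
move=> GP fb0 fb1 b01 vfun vinj; have [h hG hinj] := square_injection_fun GP.
have fh b b' : field_of G b -> field_of G b' -> field_of G (h b b').
  by move=> fb fb'; have [+ _ _ _] := GP => /(_ _ _ _ (hG _ _ fb fb'))[].
exists (fun e => if e \in field_of G then h e b0 else h (v e) b1) => [e Ee /=|].
  case: ifPn => [/set_mem fe|/negP fe]; first exact: fh.
  by apply: fh => //; apply: vfun; split=> // /mem_set.
move=> e e' /set_mem Ee /set_mem Ee' /=.
case: ifPn => [/set_mem fe|/negP fe]; case: ifPn => [/set_mem fe'|/negP fe'].
- by move=> /(hinj _ _ _ _ fe fb0 fe' fb0)[].
- have ve' : (E `\` field_of G) e' by split=> // /mem_set.
  by move=> /(hinj _ _ _ _ fe fb0 (vfun _ ve') fb1)[_ /b01].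
- have ve : (E `\` field_of G) e by split=> // /mem_set.
  by move=> /(hinj _ _ _ _ (vfun _ ve) fb1 fe' fb0)[_ /esym/b01].
- have ve : (E `\` field_of G) e by split=> // /mem_set.
  have ve' : (E `\` field_of G) e' by split=> // /mem_set.
  move=> /(hinj _ _ _ _ (vfun _ ve) fb1 (vfun _ ve') fb1)[vv _].
  by apply: vinj => //; exact: mem_set.
Qed.

(** If a copy C of B lies outside B, then B + C injects into B by
    [doubling_injection], so that the pairs of (B + C) x (B + C) that are not
    in B x B can all be given distinct values in C. *)
Lemma square_injection_extend G (b0 b1 : T) (w : T -> T) :
  square_injection G -> field_of G b0 -> field_of G b1 -> b0 <> b1 ->
  set_fun (field_of G) (A `\` field_of G) w -> set_inj (field_of G) w ->
  exists2 H, square_injection H & G `<` H.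
Proof.
move=> GP fb0 fb1 b01 wfun winj; set B := field_of G.
have GA : B `<=` A by move=> b [c Gb]; have [+ _ _ _] := GP => /(_ _ _ _ Gb)[].
pose E := B `|` w @` B.
have EB e : E e -> ~ B e -> exists2 b, B b & w b = e by move=> [|[b]] //; exists b.
have back e : exists b, E e -> ~ B e -> B b /\ w b = e.
  have [[Ee nBe]|ne] := pselect (E e /\ ~ B e).
    by have [b Bb wb] := EB e Ee nBe; exists b.
  by exists e => Ee nBe; exfalso; apply: ne.
have [v vw] := choice back.
have [||u uE uinj] := @doubling_injection G b0 b1 E v GP fb0 fb1 b01.
- by move=> e [Ee nBe]; have [] := vw e Ee nBe.
- move=> e e' /set_mem[Ee nBe] /set_mem[Ee' nBe'] vv.
  by rewrite -(vw e Ee nBe).2 vv (vw e' Ee' nBe').2.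
have [h hG hinj] := square_injection_fun GP.
have Bh e e' : E e -> E e' -> B (h (u e) (u e')).
  move=> Ee Ee'; have [+ _ _ _] := GP.
  by move=> /(_ _ _ _ (hG _ _ (uE _ Ee) (uE _ Ee')))[].
(* The new pairs take their values in the copy [w @` B] of B. *)
pose N := [set t : T * T * T | [/\ E t.1.1, E t.1.2, ~ (B t.1.1 /\ B t.1.2) &
   t.2 = w (h (u t.1.1) (u t.1.2))]].
pose H := G `|` N.
have GN b b' c d : G (b, b', c) -> N (b, b', d) -> False.
  move=> Gb [_ _ nB _]; have [+ _ _ _] := GP => /(_ _ _ _ Gb)[fb fb' _ _].
  exact: nB.
have GNc b b' c d d' : G (b, b', c) -> N (d, d', c) -> False.
  move=> Gb [/= Ed Ed' _ ce]; have [+ _ _ _] := GP => /(_ _ _ _ Gb)[_ _ fc _].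
  by have [_] := wfun _ (Bh d d' Ed Ed'); rewrite -ce.
have fH : field_of H = E.
  apply/seteqP; split=> e.
    by move=> [c [Ge|[]//]]; left; exists c.
  have [Be|nBe] := pselect (B e).
    by move=> _; have [c Gc] := Be; exists c; left.
  by move=> Ee; eexists; right; split=> //= -[].
exists H; last first.
  split=> [t Gt|NG]; first by left.
  have nB : ~ B (w b0) by have [] := wfun b0 fb0.
  have Ew : E (w b0) by right; exists b0.
  suff : G (w b0, w b0, w (h (u (w b0)) (u (w b0)))).
    by move=> Gw; apply: nB; eexists; exact: Gw.
  by apply: NG; right; split=> //= -[].
split.
- rewrite fH => b b' c [Gb|[/= Eb Eb' nBb ->]].
    have [+ _ _ _] := GP => /(_ _ _ _ Gb)[fb fb' fc Ab].
    by split=> //; left.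
  split=> //; first by right; exists (h (u b) (u b')) => //; exact: Bh.
  by case: Eb => [/GA|[d Bd <-]] //; have [] := wfun d Bd.
- rewrite fH => b b' Eb Eb'.
  have [[Bb Bb']|nBb] := pselect (B b /\ B b').
    by exists (h b b'); left; exact: hG.
  by exists (w (h (u b) (u b'))); right; split.
- move=> b b' c c' [Gc|Nc] [Gc'|Nc'].
  + by have [_ _ + _] := GP; apply; [exact: Gc|exact: Gc'].
  + by case: (GN _ _ _ _ Gc Nc').
  + by case: (GN _ _ _ _ Gc' Nc).
  + by case: Nc => _ _ _ /= ->; case: Nc' => _ _ _ /= ->.
- move=> b b' d d' c [Gb|Nb] [Gd|Nd].
  + by have [_ _ _ +] := GP; apply; [exact: Gb|exact: Gd].
  + by case: (GNc _ _ _ _ _ Gb Nd).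
  + by case: (GNc _ _ _ _ _ Gd Nb).
  + case: Nb => /= Eb Eb' _ cb; case: Nd => /= Ed Ed' _; rewrite cb => ww.
    have /hinj[] : h (u b) (u b') = h (u d) (u d').
      by apply: winj => //; apply: mem_set; exact: Bh.
    1-4: exact: uE.
    by move=> ub ub'; split; apply: uinj => //; exact: mem_set.
Qed.

(** A maximal injection B x B -> B, started from a pairing function on a
    countable subset, cannot be extended, so the complement of B in A injects
    into B; then so does A. *)
Lemma card_square : infinite_set A -> A `*` A #<= A.
Proof.
move=> Ainf; have [a0 Aa0] := infinite_setN0 Ainf.
have [f fA finj] := card_le_funP a0 ((infiniteP A).1 Ainf).
have {}finj : injective f by move=> m n; apply: finj; exact: mem_set.
pose G0 := [set t : T * T * T | exists m n, t = (f m, f n, f (pickle (m, n)))].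
have fG0 : field_of G0 = range f.
  apply/seteqP; split=> [b [c [m [n [-> _ _]]]]|_ [m _ <-]]; first by exists m.
  by exists (f (pickle (m, m))); exists m, m.
have G0P : square_injection G0.
  split.
  - rewrite fG0 => _ _ _ [m [n [-> -> ->]]].
    split; [by exists m|by exists n|by exists (pickle (m, n))|exact: fA].
  - by rewrite fG0 => _ _ [m _ <-] [n _ <-]; exists (f (pickle (m, n))), m, n.
  - by move=> b b' c c' [m [n [-> -> ->]]] [m' [n' [/finj-> /finj-> ->]]].
  - move=> b b' d d' c [m [n [-> -> ->]]] [m' [n' [-> -> /finj]]].
    by move=> /(pcan_inj pickleK)[-> ->].
have [G [GP Gmax]] : exists G, square_injection (G0 `|` G) /\
    forall H, G `<` H -> ~ square_injection (G0 `|` H).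
  apply: (@Zorn_bigcup _ (fun G => square_injection (G0 `|` G))) => F FP Ftot.
  have [F0|F0] := eqVneq F set0.
    by rewrite F0 bigcup_set0 setU0.
  move/set0P: F0 => [X0 FX0].
  have -> : G0 `|` \bigcup_(X in F) X = \bigcup_(Y in [set G0 `|` X | X in F]) Y.
    rewrite bigcup_image; apply/seteqP; split=> t.
      by move=> [G0t|[X FX Xt]]; [exists X0; [|left]|exists X; [|right]].
    by move=> [X FX [G0t|Xt]]; [left|right; exists X].
  apply: square_injection_bigcup.
  - move=> _ _ [X FX <-] [Y FY <-].
    by have [XY|YX] := Ftot _ _ FX FY; [left|right]; apply: setUS.
  - by move=> _ [X FX <-]; exact: FP.
set H := G0 `|` G in GP; set B := field_of H.
have Bf n : B (f n) by exists (f (pickle (n, n))); left; exists n, n.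
have f01 : f 0%N <> f 1%N by move=> /finj.
have BA : B `<=` A by move=> b [c Gb]; have [+ _ _ _] := GP => /(_ _ _ _ Gb)[].
have [/(card_le_funP a0)[w wfun winj]|/(card_le_funP a0)[v vfun vinj]] :=
    card_le_total B (A `\` B).
  have [K KP HK] := square_injection_extend GP (Bf 0%N) (Bf 1%N) f01 wfun winj.
  exfalso; apply: (Gmax K); last first.
    by rewrite (_ : G0 `|` K = K)//; apply/setUidPr => t G0t; apply: HK.1; left.
  split=> [t Gt|KG]; first by apply: HK.1; right.
  by apply: HK.2 => t Kt; right; exact: KG.
have [u uA uinj] := doubling_injection GP (Bf 0%N) (Bf 1%N) f01 vfun vinj.
have [h hG hinj] := square_injection_fun GP.
apply: (@fun_card_le _ _ _ _ (fun q => h (u q.1) (u q.2))) => [[a a'] [/= Aa Aa']|].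
  apply: BA; have [+ _ _ _] := GP.
  by move=> /(_ _ _ _ (hG _ _ (uA _ Aa) (uA _ Aa')))[].
move=> [a a'] [d d'] /set_mem[/= Aa Aa'] /set_mem[/= Ad Ad'] hh.
have [] := hinj _ _ _ _ (uA _ Aa) (uA _ Aa') (uA _ Ad) (uA _ Ad') hh.
by move=> ua ua'; congr pair; apply: uinj => //; exact: mem_set.
Qed.

End square.

(** * Meager sets of the Cantor space *)

Lemma nbhs_cylinder (x : cantor_space) N :
  nbhs x [set w : cantor_space | forall i, (i < N)%N -> w i = x i].
Proof.
elim: N => [|N IH]; first by apply: filterS filterT => w _ i.
have cN : nbhs x [set w : cantor_space | w N = x N].
  have nb : nbhs (x N) [set x N] by exact: discrete_set1.
  exact: (@proj_continuous nat (fun=> bool) N x _ nb).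
apply: filterS (filterI IH cN) => w [wx wN] i.
by rewrite ltnS leq_eqVlt => /predU1P[->//|/wx].
Qed.

(** The cylinders at x generate a filter that converges to x because it does
    so coordinatewise. *)
Lemma nbhs_cylinderP (x : cantor_space) (U : set cantor_space) : nbhs x U ->
  exists N, forall w : cantor_space, (forall i, (i < N)%N -> w i = x i) -> U w.
Proof.
pose cyl N := [set w : cantor_space | forall i, (i < N)%N -> w i = x i].
have cylF : Filter (filter_from setT cyl).
  apply: filter_from_filter; first by exists 0%N.
  move=> m n _ _; exists (maxn m n) => // w wx; split => i lti; apply: wx.
    by rewrite leq_max lti.
  by rewrite leq_max lti orbT.
have : filter_from setT cyl --> x.
  apply/cvg_sup => i; apply/cvg_image => //.
    by rewrite eqEsubset; split=> // b _; exists (fun=> b).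
  move=> V nV; exists [set w : cantor_space | V (w i)].
    by exists i.+1 => // w wx /=; rewrite wx //; exact: nbhs_singleton.
  by rewrite eqEsubset; split=> [b [w Vw <-]//|b Vb]; exists (fun=> b).
by move=> /[apply] -[N _ cU]; exists N.
Qed.

Lemma nowhere_denseP (F : set cantor_space) :
  nowhere_dense F <->
  forall (x : cantor_space) N, exists (y : cantor_space) k,
    (forall i, (i < N)%N -> y i = x i) /\
    forall w : cantor_space, (forall i, (i < k)%N -> w i = y i) -> ~ F w.
Proof.
split=> [F0 x N|Fcyl].
  apply: contrapT => nex.
  suff : interior (closure F) x by rewrite F0.
  rewrite /interior; apply: filterS (nbhs_cylinder x N) => y yx U nU.
  apply: contrapT => FU0; apply: nex.
  have [k kU] := nbhs_cylinderP nU.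
  by exists y, k; split=> // w wy Fw; apply: FU0; exists w; split=> //; exact: kU.
rewrite /nowhere_dense -subset0 => x /nbhs_cylinderP[N NF].
have [y [k [yx yF]]] := Fcyl x N.
have /(_ _ (nbhs_cylinder y k)) [w [Fw wy]] := NF y yx.
exact: yF Fw.
Qed.

Lemma meager_sub (A B : set cantor_space) : A `<=` B -> meager B -> meager A.
Proof.
move=> AB [F [F0 BF]]; exists (fun n => F n `&` A); split=> [n|].
  apply/nowhere_denseP => x N; have [y [k [yx yF]]] := (nowhere_denseP _).1 (F0 n) x N.
  by exists y, k; split=> // w /yF nF [].
rewrite -setI_bigcupl -BF; apply/esym/setIidr/AB.
Qed.

(** The hypothesis says that each [V n] contains a dense union of cylinders. *)
Lemma meager_not_dense_open (V : nat -> set cantor_space) :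
  (forall n (x : cantor_space) N, exists (y : cantor_space) k,
    (forall i, (i < N)%N -> y i = x i) /\
    forall w : cantor_space, (forall i, (i < k)%N -> w i = y i) -> V n w) ->
  meager [set x | ~ forall n, V n x].
Proof.
move=> Vd; exists (fun n => ~` V n); split=> [n|].
  apply/nowhere_denseP => x N; have [y [k [yx yV]]] := Vd n x N.
  by exists y, k; split=> // w /yV Vw; exact.
by rewrite -setC_bigcap; congr (~` _); apply/seteqP; split=> x Vx // n; exact: Vx.
Qed.

(** A combinatorial bound on meager sets.  Write M as a union of nowhere dense
    F 0, F 1, ...  Since there are finitely many words of length n, a single
    pattern [Y n] between n and [B n] can be found that, appended to any of
    them, leaves F 0, ..., F n; so a point of F K cannot follow [Y n] for
    n >= K.  Enlarging [B n] is harmless, whence the monotonicity. *)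
Lemma meager_windows (M : set cantor_space) : meager M ->
  exists (Y : nat -> nat -> bool) (B : nat -> nat),
    [/\ {homo B : m n / (m <= n)%N}, forall n, (n < B n)%N &
    forall x, M x -> exists K, forall n, (K <= n)%N ->
      exists2 i, (n <= i < B n)%N & x i <> Y n i].
Proof.
move=> [F [F0 ->]].
have step n (Q : seq (seq bool * nat)) :
    exists (y : nat -> bool) k, forall q, q \in Q -> forall w : cantor_space,
      (forall i, (i < n)%N -> w i = nth false q.1 i) ->
      (forall i, (n <= i < k)%N -> w i = y i) -> ~ F q.2 w.
  elim: Q => [|[s j] Q [y [k IH]]]; first by exists (fun=> false), 0%N.
  have [y' [k' [y'x y'F]]] := (nowhere_denseP _).1 (F0 j)
    (fun i => if (i < n)%N then nth false s i else y i) (maxn n k).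
  exists y', (maxn k k') => q; rewrite inE => /predU1P[->|Qq] w wq wy.
    apply: y'F => i ik'; have [ilt|ige] := ltnP i n; last first.
      by rewrite wy // ige leq_max ik' orbT.
    by rewrite wq// y'x ?leq_max ?ilt.
  apply: (IH q Qq) => // i /andP[ni ik].
  rewrite wy ?ni ?leq_max ?ik// y'x; last by rewrite leq_max ik orbT.
  by rewrite ltnNge ni.
have win n : exists yk : (nat -> bool) * nat, forall w : cantor_space,
    (forall i, (n <= i < yk.2)%N -> w i = yk.1 i) ->
    forall j, (j <= n)%N -> ~ F j w.
  pose Q := [seq (tval s, j) | s <- enum {: n.-tuple bool}, j <- iota 0 n.+1].
  have [y [k ykF]] := step n Q; exists (y, k) => w wy j jn.
  pose s := [tuple w i | i < n].
  apply: (ykF (tval s, j)) => // [|i ilt].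
    by apply: allpairs_f; rewrite ?mem_enum// mem_iota.
  by rewrite (nth_map (Ordinal ilt)) ?size_enum_ord// nth_enum_ord.
have [yk ykF] := choice win.
exists (fun n => (yk n).1), (fun n => n.+1 + \sum_(m < n.+1) (yk m).2)%N; split.
- move=> m n mn; rewrite leq_add ?ltnS//.
  rewrite -2!(big_mkord xpredT (fun i => (yk i).2)).
  by rewrite [leqRHS](big_cat_nat (n := m.+1)) ?leq_addr.
- by move=> n; rewrite addSn ltnS leq_addr.
- move=> x [j _ Fx]; exists j => n jn; apply: contrapT => nex.
  apply: (ykF n x _ _ jn Fx) => i /andP[ni ik]; apply: contrapT => xi.
  apply: nex; exists i => //; rewrite ni /=; apply: leq_trans ik _.
  by rewrite big_ord_recr /=; lia.
Qed.

Lemma glue_windows (e : nat -> nat) (Y : nat -> nat -> bool) :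
  {homo e : m n / (m <= n)%N} ->
  exists y : nat -> bool, forall k i, (e k <= i < e k.+1)%N -> y i = Y k i.
Proof.
move=> e_mono; exists (fun i => `[< exists2 k, (e k <= i < e k.+1)%N & Y k i >]).
move=> k i ki; apply/asboolP/idP => [[l li Yli]|Yki]; last by exists k.
suff <- : l = k by [].
have [lk|kl|//] := ltngtP l k.
  by have := e_mono _ _ lk; lia.
by have := e_mono _ _ kl; lia.
Qed.

(** Follow the patterns of [meager_windows] on consecutive intervals. *)
Lemma not_meagerT : ~ meager [set: cantor_space].
Proof.
move=> /meager_windows[Y [B [_ Blt YB]]].
pose e k := iter k B 0%N.
have e_mono : {homo e : m n / (m <= n)%N}.
  by apply: homo_leq => [//|m n p|n]; [exact: leq_trans|rewrite /= ltnW].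
have eK k : (k <= e k)%N by elim: k => // k IH; exact: leq_ltn_trans IH (Blt _).
have [y yE] := glue_windows (fun k => Y (e k)) e_mono.
have [K KB] := YB y I.
by have [i iK] := KB _ (eK K); apply; exact: yE.
Qed.

(** * Generic enumerations of the natural numbers *)

(** The numbers listed by the recipe [x] after [k] stages.  Stage [k] reads two
    bits: the odd one asks to list everything up to [k] that is still missing,
    the even one to list [k] itself. *)
Fixpoint coded_list (x : nat -> bool) (k : nat) : seq nat :=
  if k is k'.+1 then
    let o := coded_list x k' in
    if x k'.*2.+1 then o ++ [seq i <- iota 0 k | i \notin o]
    else if x k'.*2 then rcons o k' else o
  else [::].

Lemma coded_listS x k : coded_list x k.+1 =
  if x k.*2.+1 then coded_list x k ++ [seq i <- iota 0 k.+1 | i \notin coded_list x k]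
  else if x k.*2 then rcons (coded_list x k) k else coded_list x k.
Proof. by []. Qed.

Lemma coded_list_uniq x k :
  uniq (coded_list x k) /\ {in coded_list x k, forall i, (i < k)%N}.
Proof.
elim: k => // k [ou olt]; rewrite coded_listS; case: ifP => _; last case: ifP => _.
- rewrite cat_uniq ou filter_uniq ?iota_uniq// andbT; split.
    by apply/hasPn => i; rewrite mem_filter => /andP[].
  move=> i; rewrite mem_cat mem_filter mem_iota => /orP[/olt|/andP[_]]; lia.
- rewrite rcons_uniq ou andbT; split; first by apply/negP => /olt; rewrite ltnn.
  by move=> i; rewrite mem_rcons inE => /predU1P[->//|/olt]; lia.
- by split=> // i /olt; lia.
Qed.

Lemma coded_list_prefix x m n : (m <= n)%N ->
  exists s, coded_list x n = coded_list x m ++ s.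
Proof.
move=> /subnK<-; elim: (n - m)%N => [|d [s IH]]; first by exists [::]; rewrite cats0.
rewrite addSn coded_listS IH; case: ifP => _; last case: ifP => _.
- by eexists; rewrite -catA.
- by eexists; rewrite -cats1 -catA.
- by exists s.
Qed.

Lemma eq_coded_list x y k : (forall i, (i < k.*2)%N -> x i = y i) ->
  coded_list x k = coded_list y k.
Proof.
elim: k => // k IH xy; rewrite !coded_listS IH => [|i ik]; last by apply: xy; lia.
by rewrite !xy //; lia.
Qed.

Lemma limit_enumeration (o : nat -> seq nat) :
  (forall k, uniq (o k)) ->
  (forall m n, (m <= n)%N -> exists s, o n = o m ++ s) ->
  (forall i, exists k, i \in o k) ->
  exists s t : nat -> nat, [/\ cancel s t, cancel t s &
    forall k, o k = mkseq s (size (o k))].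
Proof.
move=> ou oext ocov.
have omem m n i : (m <= n)%N -> i \in o m -> i \in o n.
  by move=> /oext[s ->] im; rewrite mem_cat im.
have long n : exists k, (n < size (o k))%N.
  have [k kn] : exists k, {subset iota 0 n.+1 <= o k}.
    elim: n.+1 => [|m [k IH]]; first by exists 0%N.
    have [l ml] := ocov m; exists (maxn k l) => i.
    rewrite mem_iota /= add0n ltnS leq_eqVlt => /predU1P[->|im].
      exact: omem (leq_maxr _ _) ml.
    by apply: omem (leq_maxl _ _) _; apply: IH; rewrite mem_iota.
  by exists k; have := uniq_leq_size (iota_uniq 0 n.+1) kn; rewrite size_iota.
have nthE k l n : (n < size (o k))%N -> (n < size (o l))%N ->
    nth 0%N (o k) n = nth 0%N (o l) n.
  wlog kl : k l / (k <= l)%N => [wl nk nl|].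
    by have [/wl|/ltnW/wl] := leqP k l => ->.
  by have [s ->] := oext _ _ kl => nk _; rewrite nth_cat nk.
have [K KP] := choice long.
pose s n := nth 0%N (o (K n)) n.
have sE k n : (n < size (o k))%N -> s n = nth 0%N (o k) n by move=> nk; exact: nthE.
have sinj : injective s.
  move=> m n smn.
  wlog : m n smn / (size (o (K m)) <= size (o (K n)))%N => [wl|le].
    by have [/wl->|/ltnW/wl->] := leqP (size (o (K m))) (size (o (K n))).
  have mn : (m < size (o (K n)))%N by apply: leq_trans le.
  by move/eqP: smn; rewrite !(sE (K n))// nth_uniq// => /eqP.
have ssurj i : exists n, s n = i.
  have [k ik] := ocov i; exists (index i (o k)).
  by rewrite (sE k) ?nth_index ?index_mem.
have [t st] := choice ssurj.
exists s, t; split=> // [n|k]; first exact: sinj.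
apply: (@eq_from_nth _ 0%N) => [|i ik]; first by rewrite size_mkseq.
by rewrite nth_mkseq// (sE k).
Qed.

(** [s x] is the enumeration coded by [x], or the identity when some number is
    never listed, and [t x] is its inverse.  The goals [G n] are met by initial
    segments of generic enumerations as soon as every finite list [o] can be
    extended to meet them by listing, in order, the elements of some set [B]
    in some interval: this is what the even bits can do after a stage that lists
    the missing numbers, and that stage also puts [n] in the list, so that
    generic recipes miss no number. *)
Lemma generic_enumeration : exists s t : cantor_space -> nat -> nat,
  [/\ forall x, cancel (s x) (t x), forall x, cancel (t x) (s x) &
  forall G : nat -> seq nat -> Prop,
    (forall n o N, exists (B : pred nat) m, G n (o ++ [seq i <- iota N m | B i])) ->
    meager [set x | ~ forall n, exists k, G n (mkseq (s x) k)]].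
Proof.
have decode (x : cantor_space) : exists st : (nat -> nat) * (nat -> nat),
    [/\ cancel st.1 st.2, cancel st.2 st.1 & (forall i, exists k, i \in coded_list x k) ->
      forall k, coded_list x k = mkseq st.1 (size (coded_list x k))].
  have [cov|ncov] := pselect (forall i, exists k, i \in coded_list x k); last first.
    by exists (id, id).
  have [k||s [t [st ts sE]]] := @limit_enumeration (coded_list x) _ _ cov.
  - exact: (coded_list_uniq x k).1.
  - exact: coded_list_prefix.
  - by exists (s, t).
have [st stP] := choice decode.
exists (fun x => (st x).1), (fun x => (st x).2).
split=> [x|x|G Gdense]; [by have [] := stP x|by have [] := stP x|].
pose V n (x : cantor_space) :=
  exists k, n \in coded_list x k /\ G n (coded_list x k).
apply: (@meager_sub _ [set x | ~ forall n, V n x]).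
  move=> x /= nG VG; apply: nG => n; have [k [_ Gk]] := VG n.
  have [_ _ sE] := stP x; exists (size (coded_list x k)).
  by rewrite -sE// => i; have [l [il _]] := VG i; exists l.
apply: meager_not_dense_open => n x N.
(* Stage K lists the missing numbers, among them n; from stage K + 1 on the
   recipe lists the elements of B. *)
pose K := maxn n N; pose y1 i := if (i < N)%N then x i else true.
pose o := coded_list y1 K.+1.
have [B [m GB]] := Gdense n o K.+1.
pose y i := if (i < K.+1.*2)%N then y1 i else if odd i then false else B i./2.
have yo j : coded_list y (K.+1 + j) = o ++ [seq i <- iota K.+1 j | B i].
  elim: j => [|j IH].
    rewrite addn0 cats0; apply: eq_coded_list => i iK.
    by rewrite /y iK.
  rewrite addnS coded_listS IH -(addn1 j) iotaD filter_cat.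
  have -> : y (K.+1 + j).*2.+1 = false.
    by rewrite /y ltnNge ltnW ?ltnS ?leq_double ?leq_addr //= odd_double.
  have -> : y (K.+1 + j).*2 = B (K.+1 + j).
    by rewrite /y ltnNge leq_double leq_addr odd_double doubleK.
  by case: ifP => BK; rewrite /= BK ?cats0// -cats1 catA.
exists y, (K.+1 + m).*2; split=> [i iN|w wy].
  by rewrite /y /y1 iN; case: ifP => //; rewrite /K; lia.
exists (K.+1 + m)%N; rewrite (eq_coded_list wy) yo; split=> //.
rewrite mem_cat; apply/orP; left; rewrite /o coded_listS.
have -> : y1 K.*2.+1 = true by rewrite /y1; case: ifP => //; rewrite /K; lia.
rewrite mem_cat mem_filter mem_iota.
by case: (n \in coded_list y1 K) => //=; rewrite /K; lia.
Qed.

Local Open Scope ring_scope.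

(** * Generic enumerations break densities and sums *)

Lemma infinite_natP (A : set nat) :
  infinite_set A <-> forall N, exists2 n, (N <= n)%N & A n.
Proof.
split=> [Ainf N|Aub /finite_seqP[s As]].
  apply: contrapT => nA; apply: Ainf; apply: (sub_finite_set _ (finite_II N)) => n An.
  by rewrite /= ltnNge; apply/negP => Nn; apply: nA; exists n.
have [n sn] := Aub (\max_(i <- s) i).+1.
rewrite As /= => ns; move: sn; rewrite ltnNge.
by rewrite (@leq_bigmax_seq _ s xpredT id n ns isT).
Qed.

Lemma infinite_filter_iota (B : pred nat) N K :
  (forall N, exists2 n, (N <= n)%N & B n) ->
  exists m, (K <= size [seq i <- iota N m | B i])%N.
Proof.
move=> Bub; elim: K => [|K [m IH]]; first by exists 0%N.
have [n Nn Bn] := Bub (N + m)%N; exists (n - N).+1.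
have -> : (n - N).+1 = (m + ((n - N - m) + 1))%N by lia.
rewrite iotaD iotaD !filter_cat !size_cat /=.
have -> : (N + m + (n - N - m))%N = n by lia.
by rewrite Bn /=; lia.
Qed.

Section frequency.
Variable R : realType.

Definition preserves_density (p : nat -> nat) (A : set nat) : Prop :=
  has_density R (p @` A) /\ density R (p @` A) = density R A.

Lemma image_freqE (s t : nat -> nat) (A : set nat) n : cancel s t -> cancel t s ->
  initial_freq R (t @` A) n = (count (mem A) (mkseq s n))%:R / n%:R.
Proof.
move=> st ts; rewrite /initial_freq; congr (_%:R / _).
rewrite cardE size_filter -enumT -[X in mkseq _ X]size_enum_ord /mkseq.
rewrite size_enum_ord -val_enum_ord -map_comp count_map enumT.
apply: eq_count => i /=; rewrite !inE.
apply/idP/idP => /set_mem; last by move=> As; apply/mem_set; exists (s i).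
by move=> [a Aa <-]; apply/mem_set; rewrite ts.
Qed.

(** Even goals ask for an initial segment in which A has frequency at most 1/3,
    odd ones for frequency at least 2/3; both are reached by listing long enough
    runs outside A, resp. inside A. *)
Lemma density_breaking : exists p : cantor_space -> nat -> nat,
  (forall x, Sym (p x)) /\ forall A, D R A ->
    meager [set x | preserves_density (p x) A].
Proof.
have [s [t [st ts generic]]] := generic_enumeration.
exists t; split=> [x|A [Ainf Acinf _]]; first by exists (s x).
pose G n (o : seq nat) := (n < size o)%N /\
  if odd n then (2 * size o <= 3 * count (mem A) o)%N
  else (3 * count (mem A) o <= size o)%N.
apply: meager_sub (generic G _) => [x [dA _] /= gen|n o N].
  move/cvg_ex: dA => [l /cvgrPdist_lt/(_ (1/6%:R))] /=.
  case=> [|N _ NA]; first by lra.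
  have near_l n : exists k, [/\ (0 < k)%N,
       `|l - (count (mem A) (mkseq (s x) k))%:R / k%:R| < 1/6 &
       if odd n then (2 * k <= 3 * count (mem A) (mkseq (s x) k))%N
     else (3 * count (mem A) (mkseq (s x) k) <= k)%N].
    have [k [nk ck]] := gen (n + N.*2)%N.
    exists k; move: nk ck; rewrite size_mkseq oddD odd_double addbF => nk ck.
    split=> //; first by lia.
    by rewrite -(@image_freqE _ (t x))//; apply: NA => /=; lia.
  have [k [k0 kl /= kA]] := near_l 0%N.
  have [m [m0 ml /= mA]] := near_l 1%N.
  have k0' : 0 < k%:R :> R by rewrite ltr0n.
  have m0' : 0 < m%:R :> R by rewrite ltr0n.
  have : (count (mem A) (mkseq (s x) k))%:R / k%:R <= 1/3 :> R.
    rewrite ler_pdivrMr//; move: kA; rewrite -(ler_nat R) natrM; lra.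
  have : 2/3 <= (count (mem A) (mkseq (s x) m))%:R / m%:R :> R.
    rewrite ler_pdivlMr//; move: mA; rewrite -(ler_nat R) !natrM; lra.
  move: kl ml; rewrite !ltr_norml => /andP[? ?] /andP[? ?]; lra.
pose B i := if odd n then i \in A else i \notin A.
have [|m mB] := @infinite_filter_iota B N (2 * size o + n).+1.
  move=> K; rewrite /B; case: (odd n).
    by have [i Ki Ai] := (infinite_natP A).1 Ainf K; exists i => //; apply/mem_set.
  have [i Ki Ai] := (infinite_natP _).1 Acinf K.
  by exists i => //; apply/negP => /set_mem.
have AB : count (mem A) [seq i <- iota N m | B i] =
    (odd n * size [seq i <- iota N m | B i])%N.
  rewrite count_filter size_filter; case: (boolP (odd n)) => nodd.
    by rewrite mul1n; apply: eq_count => i; rewrite /B /= nodd andbb.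
  rewrite -[RHS](count_pred0 (iota N m)); apply: eq_count => i.
  by rewrite /B /= (negbTE nodd) andbN.
exists B, m; rewrite /G size_cat count_cat AB; split; first by lia.
by have := count_size (mem A) o; case: (odd n); lia.
Qed.

(** If the positive terms had bounded partial sums then so would the absolute
    values, since |a| = 2 max(a, 0) - a and the series of [a] converges. *)
Lemma positive_part_unbounded (a : R^nat) N (K : R) : conditionally_convergent a ->
  exists m, K <= \sum_(i <- iota N m | 0 < a i) a i.
Proof.
move=> [acvg anorm]; apply: contrapT => nK; apply: anorm.
have posK n : \sum_(i <- iota N n | 0 < a i) a i <= K.
  by rewrite leNgt; apply/negP => /ltW Kn; apply: nK; exists n.
have [M [Mr MP]] := cvg_seq_bounded acvg.
have {}MP n : - (M + 1) <= series a n.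
  have := MP (M + 1) _ n I; rewrite ltrDl ltr01 => /(_ isT).
  by rewrite /= ler_norml => /andP[].
change (cvgn (series (fun i => `|a i|))); apply: nondecreasing_is_cvgn.
  by apply/nondecreasing_seqP => n; rewrite /series /= big_nat_recr//= lerDl.
exists (2 * (K + \sum_(0 <= i < N | 0 < a i) a i) + (M + 1)) => _ [n _ <-].
have -> : series (fun i => `|a i|) n = 2 * \sum_(0 <= i < n | 0 < a i) a i - series a n.
  rewrite /series /= [X in _ = 2 * X - _]big_mkcond mulr_sumr -sumrB /=.
  apply: eq_bigr => i _.
  by have [ai|ai] := ltP 0 (a i); rewrite ?(gtr0_norm ai) ?(ler0_norm ai); lra.
suff : \sum_(0 <= i < n | 0 < a i) a i <= K + \sum_(0 <= i < N | 0 < a i) a i.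
  by have := MP n; lra.
have K0 : 0 <= K by have := posK 0%N; rewrite big_nil.
have [nN|Nn] := leqP n N.
  rewrite (big_cat_nat (n := n) (p := N)) //=.
  have : 0 <= \sum_(n <= i < N | 0 < a i) a i by apply: sumr_ge0 => i /ltW.
  lra.
rewrite (@big_cat_nat _ _ _ N) ?(ltnW Nn)//= addrC lerD2r.
exact: (posK (n - N)%N).
Qed.

(** Listing many positive terms makes the partial sums exceed any bound. *)
Lemma series_breaking : exists p : cantor_space -> nat -> nat,
  (forall x, Sym (p x)) /\ forall a : R^nat, conditionally_convergent a ->
    meager [set x | cvgn (series (a \o p x))].
Proof.
have [s [t [st ts generic]]] := generic_enumeration.
exists s; split=> [x|a acc]; first by exists (t x).
pose G n (o : seq nat) := n%:R <= \sum_(i <- o) a i.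
apply: meager_sub (generic G _) => [x /= asx gen|n o N].
  have [M [Mr MP]] := cvg_seq_bounded asx.
  have [n Mn] : exists n, M + 1 < n%:R.
    by exists (Num.bound `|M + 1|); apply: le_lt_trans (ler_norm _) (archi_boundP _).
  have [k] := gen n.
  have := MP (M + 1) _ k I; rewrite ltrDl ltr01 => /(_ isT) /=.
  rewrite /G /mkseq big_map /series /= /index_iota subn0.
  by move=> /(le_trans (ler_norm _)); lra.
have [m mP] := positive_part_unbounded N (n%:R - \sum_(i <- o) a i) acc.
exists (fun i => 0 < a i), m; rewrite /G big_cat big_filter /=; lra.
Qed.

End frequency.

(** * Predicting functions from permutations *)

Lemma uniq_unzip1_inj (s : seq (nat * nat)) :
  uniq (unzip1 s) -> {in s &, injective fst}.
Proof.
elim: s => //= a s IH /andP[/negP as1 us] q q'; rewrite !inE.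
move=> /predU1P[->|qs] /predU1P[->|qs'] // qq; last exact: IH.
  by exfalso; apply: as1; rewrite qq map_f.
by exfalso; apply: as1; rewrite -qq map_f.
Qed.

(** [l i] is a list of proposals (j, c), read as: the value at j is c.  They are
    examined in turn, and from each list one proposal at a place that is not yet
    decided is accepted.  Only i places are decided before step i, so more than
    i proposals at distinct places leave a free one. *)
Lemma fresh_windows (l : nat -> seq (nat * nat)) :
  exists z : nat -> nat, forall i, uniq (unzip1 (l i)) -> (i < size (l i))%N ->
    exists2 q, q \in l i & z q.1 = q.2.
Proof.
(* [c i] lists the proposals accepted before step i. *)
pose fresh (c : seq (nat * nat)) i := [seq q <- l i | q.1 \notin unzip1 c].
pose c := fix c i := if i is i'.+1 then c i' ++ take 1 (fresh (c i') i') else [::].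
have cS i : c i.+1 = c i ++ take 1 (fresh (c i) i) by [].
have c_size i : (size (c i) <= i)%N.
  elim: i => // i IH; rewrite cS size_cat size_take.
  by case: ifP => [|/negbT]; lia.
have c_uniq i : uniq (unzip1 (c i)).
  elim: i => // i IH; rewrite cS /unzip1 map_cat cat_uniq IH /=.
  case E : (fresh (c i) i) => [|q s] //=; rewrite take0 /= andbT orbF.
  have : q \in fresh (c i) i by rewrite E mem_head.
  by rewrite mem_filter => /andP[].
have c_mono i j : (i <= j)%N -> {subset c i <= c j}.
  move=> /subnK<-; elim: (j - i)%N => // d IH q qi.
  by rewrite addSn cS mem_cat IH.
have c_fun q q' i j : q \in c i -> q' \in c j -> q.1 = q'.1 -> q = q'.
  move=> qi qj qq; have ci := c_mono _ _ (leq_maxl i j) _ qi.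
  have cj := c_mono _ _ (leq_maxr i j) _ qj.
  exact: (uniq_unzip1_inj (c_uniq (maxn i j))).
exists (fun j => xget 0%N [set k | exists i, (j, k) \in c i]) => i li szi.
have : fresh (c i) i != [::].
  apply/eqP => f0.
  have sub : {subset unzip1 (l i) <= unzip1 (c i)}.
    move=> _ /mapP[q qi ->]; apply: contraT => qc.
    have : q \in fresh (c i) i by rewrite mem_filter qc.
    by rewrite f0.
  have := uniq_leq_size li sub; rewrite !size_map => /leq_trans/(_ (c_size i)).
  by rewrite leqNgt szi.
case E : (fresh (c i) i) => [|q s] // _.
have qf : q \in fresh (c i) i by rewrite E mem_head.
have qc : q \in c i.+1 by rewrite cS E /= take0 mem_cat mem_head orbT.
exists q; first by move: qf; rewrite mem_filter => /andP[].
case: xgetP => [k _ [j /= jk]|/(_ q.2) nq].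
  by rewrite -(c_fun _ _ _ _ jk qc erefl).
by exfalso; apply: nq; exists i.+1; rewrite -surjective_pairing.
Qed.

(** The second component [k] is padding that makes codes arbitrarily large, and
    codes are even so that a set of codes has infinite complement. *)
Definition code (l : seq (nat * nat)) (k : nat) : nat := (pickle (l, k)).*2.

Definition decode (v : nat) : seq (nat * nat) :=
  (odflt ([::], 0%N) (unpickle v./2)).1.

Lemma codeK l k : decode (code l k) = l.
Proof. by rewrite /decode /code doubleK pickleK. Qed.

Lemma code_large l N : exists k, (N <= code l k)%N.
Proof.
apply: contrapT => small.
have cinj : injective (code l).
  by move=> i j /double_inj/(pcan_inj pickleK)[].
have : (N.+1 <= N)%N; last by rewrite ltnn.
rewrite -[X in (X <= _)%N](size_iota 0) -[X in (_ <= X)%N](size_iota 0)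
  -(size_map (code l)).
apply: uniq_leq_size => [|v /mapP[k _ ->]]; first by rewrite map_inj_uniq ?iota_uniq.
by rewrite mem_iota /= add0n ltnNge; apply/negP => ?; apply: small; exists k.
Qed.

(** The range has about sqrt m elements below m.  With K fixed, the indices n of
    the values below m satisfy n < N + 2K or 2K n <= n^2 < m, and these are at
    most m / K in number when m is large. *)
Lemma range_square_density0 (R : realType) (u : nat -> nat) N :
  (forall n, (N <= n)%N -> (n * n <= u n)%N) ->
  initial_freq R (range u) @ \oo --> (0 : R).
Proof.
move=> u_ge; apply/cvgrPdist_lt => /= e e0.
(* The count below m is at most m / K for large m, and 1 / K < e. *)
pose K := (Num.bound (e^-1)).+1.
have Ke : K%:R^-1 < e.
  rewrite invf_plt ?posrE ?ltr0n//; apply: lt_trans (_ : (Num.bound e^-1)%:R < _).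
    by apply: archi_boundP; rewrite invr_ge0 ltW.
  by rewrite ltr_nat.
have K0 : (0 < K)%N by [].
clearbody K; exists (K.*2 * (N + K.*2 + 1)).+1 => // m /= m_ge.
rewrite sub0r normrN ger0_norm ?divr_ge0// (le_lt_trans _ Ke)//.
have m0 : 0 < m%:R :> R by rewrite ltr0n; lia.
rewrite ler_pdivrMr// mulrC ler_pdivlMr ?ltr0n// -natrM ler_nat.
set T := (N + K.*2 + m %/ K.*2 + 1)%N.
apply: (@leq_trans (T * K)); last first.
  have := leq_trunc_div m K.*2; rewrite /T; nia.
rewrite leq_mul2r; apply/orP; right.
have -> : T = size [seq u n | n <- iota 0 T] by rewrite size_map size_iota.
rewrite cardE -(size_map (@nat_of_ord m)).
apply: uniq_leq_size.
  by rewrite map_inj_uniq ?enum_uniq//; exact: ord_inj.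
move=> _ /mapP[i + ->]; rewrite mem_enum !inE => -[n _ ni].
apply/mapP; exists n => //; rewrite mem_iota /= add0n ltnNge; apply/negP => Tn.
have mq : (m < (m %/ K.*2).+1 * K.*2)%N by apply: ltn_ceil; rewrite double_gt0.
move: Tn mq (u_ge n) (ltn_ord i); rewrite /T -ni.
move: (m %/ K.*2)%N => q Tn mq uge um.
have {}uge : (n * n <= u n)%N by apply: uge; lia.
have : (q.+1 * K.*2 <= n * n)%N by apply: leq_mul; lia.
by lia.
Qed.

Lemma uniq_beyond (X : set nat) N k : (forall N, exists2 n, (N <= n)%N & X n) ->
  exists s : seq nat, [/\ uniq s, size s = k &
    forall j, j \in s -> X j /\ (N <= j)%N].
Proof.
move=> Xub; elim: k N => [|k IH] N; first by exists [::].
have [n Nn Xn] := Xub N; have [s [us ss sX]] := IH n.+1.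
exists (n :: s); split=> [||j]; rewrite /= ?ss ?us ?andbT//.
  by apply/negP => /sX[_]; rewrite ltnn.
by rewrite inE => /predU1P[->//|/sX[Xj]]; split=> //; lia.
Qed.

(** [Z p] is obtained from [fresh_windows] applied to the lists decoded from the
    values of the inverse of [p].  The set A is the range of a sequence v where
    v n >= n^2 codes n^2 values of [g] at places of [X] beyond n.  If [p]
    destroys the density of A then p (v n) < n^2 infinitely often by
    [range_square_density0], and then v n carries enough proposals for one of
    them to be accepted. *)
Lemma sparse_prediction (R : realType) : exists Z : (nat -> nat) -> nat -> nat,
  forall (g : nat -> nat) (X : set nat),
    (forall N, exists2 n, (N <= n)%N & X n) ->
    exists2 A, D R A & forall p, Sym p ->
      ~ preserves_density R p A ->
      forall N, exists j, [/\ (N <= j)%N, X j & Z p j = g j].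
Proof.
have pred p : exists z : nat -> nat, Sym p -> forall v,
    uniq (unzip1 (decode v)) -> (p v < size (decode v))%N ->
    exists2 q, q \in decode v & z q.1 = q.2.
  have [[s ps sp]|np] := pselect (Sym p); last by exists id.
  have [z zP] := fresh_windows (decode \o s); exists z => _ v.
  by have := zP (p v); rewrite /= ps.
have [Z ZP] := choice pred; exists Z => g X Xub.
have win n : exists v : nat, [/\ ~~ odd v, (n * n <= v)%N,
    uniq (unzip1 (decode v)), size (decode v) = (n * n)%N &
    forall q, q \in decode v -> [/\ (n <= q.1)%N, X q.1 & q.2 = g q.1]].
  have [s [us ss sX]] := @uniq_beyond X n (n * n) Xub.
  have [k kn] := code_large [seq (j, g j) | j <- s] (n * n).
  exists (code [seq (j, g j) | j <- s] k); rewrite codeK; split=> //.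
  - by rewrite /code odd_double.
  - by rewrite /unzip1 -map_comp map_id_in.
  - by rewrite size_map.
  - by move=> _ /mapP[j /sX[Xj nj] ->].
have [v vP] := choice win.
have v0 : initial_freq R (range v) @ \oo --> (0 : R).
  by apply: (@range_square_density0 R v 0%N) => n _; have [] := vP n.
exists (range v).
  split.
  - apply/infinite_natP => N; exists (v N); last by exists N.
    by have [_ + _ _ _] := vP N; nia.
  - apply/infinite_natP => N; exists N.*2.+1; first by lia.
    move=> [n _ vn]; have [+ _ _ _ _] := vP n.
    by rewrite vn /= odd_double.
  - by apply/cvg_ex; exists 0.
move=> p pSym destroyed N; apply: contrapT => nj; apply: destroyed.
have pv0 : initial_freq R (p @` range v) @ \oo --> (0 : R).
  have -> : p @` range v = range (p \o v).
    exact: image_comp.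
  apply: (@range_square_density0 R (p \o v) N) => n Nn.
  rewrite leqNgt; apply/negP => pvn; apply: nj.
  have [_ _ uv sv vX] := vP n.
  have [q qv zq] := ZP p pSym (v n) uv (eq_ind_r (fun m => _ < m)%N pvn sv).
  have [nq Xq qg] := vX q qv; exists q.1; split=> //; first by lia.
  by rewrite zq.
split; first by apply/cvg_ex; exists 0.
by rewrite /density (cvg_lim _ pv0)// (cvg_lim _ v0).
Qed.

(** * Leaving a meager set with two permutations *)

Definition growth (r : nat -> nat) (n : nat) : nat := (n.+1 + \max_(m < n.+1) r m)%N.

Definition windows (r : nat -> nat) (j : nat) : nat := iter j (growth r) 0%N.

Lemma growth_mono r : {homo growth r : m n / (m <= n)%N}.
Proof.
move=> m n mn; apply: leq_add => //; apply/bigmax_leqP => i _.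
have im : (i < n.+1)%N by apply: leq_trans (ltn_ord i) _.
exact: (leq_bigmax (Ordinal im)).
Qed.

Lemma growth_ge r n : (r n <= growth r n)%N.
Proof. exact: leq_trans (leq_bigmax ord_max) (leq_addl _ _). Qed.

Lemma windowsS r j : windows r j.+1 = growth r (windows r j).
Proof. by []. Qed.

Lemma windows_mono r : {homo windows r : m n / (m <= n)%N}.
Proof.
apply: homo_leq => [//|m n p|n]; first exact: leq_trans.
by rewrite windowsS /growth; lia.
Qed.

Lemma windows_ge r j : (j <= windows r j)%N.
Proof. by elim: j => // j IH; rewrite windowsS /growth; lia. Qed.

Lemma window_of r n : exists j, (windows r j <= n < windows r j.+1)%N.
Proof.
have [j nj jmin] :=
  ex_minnP (ex_intro (fun j => n < windows r j)%N n.+1 (windows_ge r n.+1)).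
case: j => // j in nj jmin *; exists j; rewrite nj andbT leqNgt.
by apply/negP => /jmin; rewrite ltnn.
Qed.

(** Let n be in the window j with r n >= B (B n).  If the window j, which starts
    at or before n, is too short, then it ends before B n, so the window j + 1
    is long enough: it reaches beyond [r n], hence beyond the image by [B] of
    its starting point. *)
Lemma window_large r (B : nat -> nat) :
  {homo B : m n / (m <= n)%N} ->
  (forall N, exists2 n, (N <= n)%N & r n = B (B n)) ->
  forall N, exists2 j, (N <= j)%N & (B (windows r j) <= windows r j.+1)%N.
Proof.
move=> Bmono rB N; have [n Nn rn] := rB (windows r N).
have [j /andP[jn nj]] := window_of r n.
have Nj : (N <= j)%N.
  by rewrite leqNgt; apply/negP => /(windows_mono r); lia.
have [Bj|jB] := leqP (B (windows r j)) (windows r j.+1); first by exists j.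
exists j.+1; first by lia.
rewrite [leqRHS]windowsS.
apply: leq_trans (growth_mono r (ltnW nj)).
apply: leq_trans (growth_ge r n); rewrite rn.
by apply/Bmono/(leq_trans (ltnW jB))/Bmono.
Qed.

(** The permutation [p] determines windows, and [q] a word for each of them;
    [x p q] copies these words, each on its own window.  Let [M] be bounded, as
    in [meager_windows], by patterns Y n between n and b n.  The first set makes
    [p] guess b (b n), so that some windows are long by [window_large], and the
    second one makes [q] guess the words that Y prescribes on the long windows.
    The order of the quantifiers reflects that the second set depends on the
    windows, hence on [p]. *)
Lemma two_step_prediction (R : realType) :
  exists x : (nat -> nat) -> (nat -> nat) -> cantor_space,
    forall M, meager M ->
    exists2 A, D R A & forall p, Sym p -> ~ preserves_density R p A ->
    exists2 B, D R B & forall q, Sym q -> ~ preserves_density R q B ->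
    ~ M (x p q).
Proof.
have [Z ZP] := sparse_prediction R.
pose guess q j : seq bool := odflt [::] (unpickle (Z q j)).
have glue pq : exists x : cantor_space, forall j i,
    (windows (Z pq.1) j <= i < windows (Z pq.1) j.+1)%N ->
    x i = nth false (guess pq.2 j) i.
  exact: (glue_windows (fun j => nth false (guess pq.2 j)) (windows_mono (Z pq.1))).
have [x xP] := choice glue; exists (fun p q => x (p, q)) => M.
move=> /meager_windows[Y [B [Bmono Blt YB]]].
have [|A DA AP] := ZP (fun n => B (B n)) setT; first by move=> N; exists N.
exists A => // p pSym pA; pose e := windows (Z p).
have {AP}large : forall N, exists2 j, (N <= j)%N & (B (e j) <= e j.+1)%N.
  apply: window_large => // N; have [j [Nj _ Zj]] := AP p pSym pA N.
  by exists j.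
have [A' DA' A'P] := ZP (fun j => pickle (mkseq (Y (e j)) (e j.+1))) _ large.
exists A' => // q qSym qA' Mx; have [K KP] := YB _ Mx.
have [j [Kj Bj Zj]] := A'P q qSym qA' K.
have [i /andP[ji ij]] := KP _ (leq_trans Kj (windows_ge (Z p) j)).
have iej : (i < e j.+1)%N by apply: leq_trans Bj.
by rewrite (xP (p, q) j) ?ji//= /guess Zj pickleK /= nth_mkseq.
Qed.

(** * Comparing the cardinals *)

Lemma least_card_le (T U : Type) (P : set (set T)) (Q : set (set U)) :
  Q !=set0 -> (forall B, Q B -> exists2 A, P A & A #<= B) ->
  P !=set0 /\ least_card P #<= least_card Q.
Proof.
move=> Q0 QP; have [QB _] := least_cardP Q0; have [A PA AB] := QP _ QB.
have P0 : P !=set0 by exists A.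
by split=> //; apply: card_le_trans ((least_cardP P0).2 A PA) AB.
Qed.

Section families.
Variable R : realType.

Definition density_family : set (set (nat -> nat)) :=
  [set Pi | Pi `<=` Sym /\ forall A, D R A -> exists2 p, Pi p &
      ~ has_density R (p @` A) \/ density R (p @` A) <> density R A].

Definition density_kept_family : set (set (set nat)) :=
  [set D0 | D0 `<=` D R /\ forall p, Sym p -> exists2 A, D0 A & preserves_density R p A].

Definition series_family : set (set (nat -> nat)) :=
  [set Pi | Pi `<=` Sym /\ forall a : R^nat, conditionally_convergent a ->
      exists2 p, Pi p &
      ~ cvgn (series (a \o p)) \/ limn (series (a \o p)) <> limn (series a)].

Definition meager_cover : set (set (set cantor_space)) :=
  [set F | (forall A, F A -> meager A) /\ \bigcup_(A in F) A = setT].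

Lemma not_preservesP p A : ~ preserves_density R p A <->
  ~ has_density R (p @` A) \/ density R (p @` A) <> density R A.
Proof. by rewrite -not_andP. Qed.

Lemma meager_set1 (x : cantor_space) : meager [set x].
Proof.
apply: meager_sub (@meager_not_dense_open (fun=> ~` [set x]) _).
  by move=> _ -> /(_ 0%N); exact.
move=> _ z N; exists (fun i => if (i < N)%N then z i else ~~ x i), N.+1.
split=> [i ->//|w wN wx].
by have := wN N (leqnn _); rewrite wx ltnn; case: (x N).
Qed.

Lemma meager_cover_ex : meager_cover !=set0.
Proof.
exists [set [set x] | x in setT]; split=> [_ [x _ <-]|]; first exact: meager_set1.
by apply/seteqP; split=> // x _; exists [set x] => //; exists x.
Qed.

Lemma density_family_le (X : set cantor_space) : ~ meager X ->
  exists2 Pi, density_family Pi & Pi #<= X.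
Proof.
move=> nX; have [p [pSym pM]] := density_breaking R.
exists (p @` X); last exact: card_image_le.
split=> [_ [x _ <-]//|A DA].
apply: contrapT => nA; apply/nX/(meager_sub _ (pM A DA)) => x Xx /=.
apply: contrapT => nx; apply: nA; exists (p x); first by exists x.
exact/not_preservesP.
Qed.

Lemma series_family_le (X : set cantor_space) : ~ meager X ->
  exists2 Pi, series_family Pi & Pi #<= X.
Proof.
move=> nX; have [p [pSym pM]] := series_breaking R.
exists (p @` X); last exact: card_image_le.
split=> [_ [x _ <-]//|a acc].
apply: contrapT => na; apply/nX/(meager_sub _ (pM a acc)) => x Xx /=.
by apply: contrapT => nx; apply: na; exists (p x); [exists x|left].
Qed.

Lemma meager_cover_le (D0 : set (set nat)) : density_kept_family D0 ->
  exists2 F, meager_cover F & F #<= D0.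
Proof.
move=> [D0D D0P]; have [p [pSym pM]] := density_breaking R.
exists [set [set x | preserves_density R (p x) A] | A in D0]; last exact: card_image_le.
split=> [_ [A D0A <-]|]; first by apply: pM; exact: D0D.
apply/seteqP; split=> // x _; have [A D0A xA] := D0P _ (pSym x).
by exists [set x | preserves_density R (p x) A] => //; exists A.
Qed.

(** Finitely many predictions are evaded by a function above all of them. *)
Lemma density_family_infinite Pi : density_family Pi -> infinite_set Pi.
Proof.
move=> [PiS PiP] /finite_seqP[s Pis]; have [Z ZP] := sparse_prediction R.
have [|A DA AP] := ZP (fun j => (\max_(p <- s) Z p j).+1) setT.
  by move=> N; exists N.
have [p Pip /not_preservesP pA] := PiP A DA.
have [j [_ _]] := AP p (PiS p Pip) pA 0%N.
have ps : p \in s by move: Pip; rewrite Pis.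
have := @leq_bigmax_seq _ s xpredT (fun q => Z q j) p ps isT.
by move=> + Zj; rewrite [X in (X <= _)%N]Zj ltnn.
Qed.

Lemma nonmeager_le Pi : density_family Pi ->
  exists2 X : set cantor_space, ~ meager X & X #<= Pi.
Proof.
move=> PiP; have [PiS PiD] := PiP; have [x xP] := two_step_prediction R.
exists [set x pq.1 pq.2 | pq in Pi `*` Pi]; last first.
  apply: card_le_trans (card_image_le _ _) _.
  exact/card_square/density_family_infinite.
move=> /xP[A DA AP]; have [p Pip /not_preservesP pA] := PiD A DA.
have [B DB BP] := AP p (PiS p Pip) pA.
have [q Piq /not_preservesP qB] := PiD B DB.
by apply: (BP q (PiS q Piq) qB); exists (p, q).
Qed.

(** The dual of [nonmeager_le]: the two steps are handled by a case distinction
    instead of a product.  If the first sets fail, a single [p] destroys all of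
    them, and the second sets are chosen for that [p]; a [q] that destroyed all
    of these would give a point [x p q] outside every member of the cover. *)
Lemma density_kept_family_le (F : set (set cantor_space)) : meager_cover F ->
  exists2 D0, density_kept_family D0 & D0 #<= F.
Proof.
move=> [Fm Fcov]; have [x xP] := two_step_prediction R.
have first_step M : exists A, F M -> D R A /\
    forall p, Sym p -> ~ preserves_density R p A ->
    exists2 B, D R B & forall q, Sym q -> ~ preserves_density R q B -> ~ M (x p q).
  have [FM|nFM] := pselect (F M); last by exists set0.
  by have [A DA AP] := xP M (Fm M FM); exists A.
have [A AP] := choice first_step.
have [good|bad] := pselect (density_kept_family (A @` F)).
  by exists (A @` F) => //; exact: card_image_le.
have [p [pSym pA]] : exists p, Sym p /\ forall M, F M -> ~ preserves_density R p (A M).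
  apply: contrapT => nop; apply: bad; split=> [_ [M FM <-]|p pSym].
    exact: (AP M FM).1.
  apply: contrapT => noA; apply: nop; exists p; split=> // M FM pAM.
  by apply: noA; exists (A M) => //; exists M.
have second_step M : exists B, F M -> D R B /\ forall q, Sym q ->
    ~ preserves_density R q B -> ~ M (x p q).
  have [FM|nFM] := pselect (F M); last by exists set0.
  by have [B DB BP] := (AP M FM).2 p pSym (pA M FM); exists B.
have [B BP] := choice second_step.
exists (B @` F); last exact: card_image_le.
split=> [_ [M FM <-]|q qSym]; first exact: (BP M FM).1.
apply: contrapT => noB.
have [M FM Mx] : (\bigcup_(M in F) M) (x p q) by rewrite Fcov.
apply: (BP M FM).2 Mx => // qB; apply: noB.
by exists (B M) => //; exists M.
Qed.

End families.

Theorem corollary9 (R : realType) :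
  dd R #= nonM /\ dd_perp R #= covM /\ rr R #<= dd R.
Proof.
have nonM0 : [set A : set cantor_space | ~ meager A] !=set0.
  by exists setT; exact: not_meagerT.
have [dd0 dd_le] := least_card_le nonM0 (@density_family_le R).
have [_ le_dd] := least_card_le dd0 (@nonmeager_le R).
have [_ rr_le] := least_card_le nonM0 (@series_family_le R).
have [perp0 perp_le] := least_card_le meager_cover_ex (@density_kept_family_le R).
have [_ le_perp] := least_card_le perp0 (@meager_cover_le R).
split; first by rewrite card_eq_le dd_le le_dd.
split; first by rewrite card_eq_le perp_le le_perp.
exact: card_le_trans rr_le le_dd.
Qed.
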